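(* Let $c>0$, let $\beta\in\mathcal F^0_{\mathrm{inc}}$ be the service curve offered by a FIFO system with transmission rate $c$ to $M$ flows, where flow $i\in\{1,\dots,M\}$ has packet-level arrival curve $\alpha_{\mathrm{pkt},i}$ and packet lengths in $[L_i^{\min},L_i^{\max}]$. For a flow $f$, let $$\Delta^{\mathrm{pkt}}_f=h\Big(\sum_{i=1}^{M}L_i^{\max}\alpha_{\mathrm{pkt},i}^{+}-L_f^{\max},\,\beta\Big)+\frac{L_f^{\max}}{c}$$ be the delay bound obtained directly from the packet-level arrival curves, and let $$\Delta^{\mathrm A}_f=\sup_{l\in[L_f^{\min},L_f^{\max}]}\Big\{h\Big(\sum_{i=1}^{M}L_i^{\max}\alpha_{\mathrm{pkt},i}^{+}-l,\,\beta\Big)+\frac{l}{c}\Big\}$$ be the delay bound obtained by first deriving the bit-level arrival curves $\alpha_i=L_i^{\max}\alpha_{\mathrm{pkt},i}$ and then using the bit-level arrival-curve delay bound. Then $\Delta^{\mathrm{pkt}}_f\le\Delta^{\mathrm A}_f$. Furthermore, if packets of flow $f$ have a constant size ($L_f^{\min}=L_f^{\max}$) then $\Delta^{\mathrm{pkt}}_f=\Delta^{\mathrm A}_f$; otherwise $\Delta^{\mathrm{pkt}}_f<\Delta^{\mathrm A}_f$ in general, i.e. one can find service curves for which the inequality is strict, for example a rate-latency service curve $\beta(t)=R\max(t-T,0)$ with rate $R<c$.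
   Context: $\mathcal F^0_{\mathrm{inc}}$ is the set of wide-sense increasing functions $w:[0,\infty)\to[0,\infty]$ with $w(0)=0$. $w^+$ denotes the right limit of $w$. The lower pseudo-inverse is $w^{\downarrow}(x)=\inf\{s\ge 0: w(s)\ge x\}$. The horizontal deviation from $w'$ to $w$ is $h(w',w)=\sup_{t\ge 0}\{w^{\downarrow}(w'(t))-t\}$. A packet-level arrival curve is a wide-sense increasing function $\alpha_{\mathrm{pkt}}$ from $[0,\infty)$ to the nonnegative integers, with $\alpha_{\mathrm{pkt}}(0)=0$, bounding the number of packets of the flow: if $N(t)$ is the number of packets arrived until time $t$ (excluded), $N(t)-N(s)\le\alpha_{\mathrm{pkt}}(t-s)$ for $0\le s\le t$. It is assumed sub-additive, left-continuous and with $\alpha_{\mathrm{pkt}}^+(0)\ge1$. The quantities $\Delta^{\mathrm{pkt}}_f$ and $\Delta^{\mathrm A}_f$ are both upper bounds on the time between arrival and end of transmission of any packet of flow $f$ in the FIFO system; the claim compares their values.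
   Formalization: The rate-latency example with 0 < R < c is claimed only when the packet-level bound is finite, or when the total bit-level arrival curve has an affine bound of slope below c; under overload both bounds are infinite and no such example exists. *)

(* Defs.v *)
(* Functions on [0, +oo[ are represented by total functions on R, and every
   definition below only looks at their values at nonnegative arguments. *)
From HB Require Import structures.
From mathcomp Require Import all_boot all_order all_algebra.
From mathcomp Require Import all_classical all_reals all_analysis.

Set Implicit Arguments.
Unset Strict Implicit.
Unset Printing Implicit Defensive.

Import Order.TTheory GRing.Theory Num.Theory.
Import numFieldNormedType.Exports.

Local Open Scope classical_set_scope.
Local Open Scope ring_scope.

Section curves.
Context {R : realType}.

(* The codomain [0, +oo] is enforced by the two conditions: 0 = w 0 <= w t. *)
Definition F0inc (w : R -> \bar R) : Prop :=
  w 0 = 0%E /\ (forall s t, 0 <= s -> s <= t -> (w s <= w t)%E).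

Definition right_limit (w : R -> R) (t : R) : R := lim (w s @[s --> t^'+]).

(* ereal_inf set0 = +oo, as needed when w never reaches x. *)
Definition lower_pinv (w : R -> \bar R) (x : \bar R) : \bar R :=
  ereal_inf [set s%:E | s in [set s : R | 0 <= s /\ (x <= w s)%E]].

Definition hdev (w' w : R -> \bar R) : \bar R :=
  ereal_sup [set (lower_pinv w (w' t) - t%:E)%E | t in [set t : R | 0 <= t]].

Definition rate_latency (rate latency : R) (t : R) : \bar R :=
  (rate * Num.max (t - latency) 0)%:E.

(* alpha_pkt^+, regarded as a real-valued function. *)
Definition pkt_right_limit (a : R -> nat) : R -> R :=
  right_limit (fun s => (a s)%:R).

Definition pkt_arrival_curve (a : R -> nat) : Prop :=
  [/\ a 0 = 0%N,
      forall s t, 0 <= s -> s <= t -> (a s <= a t)%N,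
      forall s t, 0 <= s -> 0 <= t -> (a (s + t)%R <= a s + a t)%N,
      forall t, 0 < t -> ((a s)%:R : R) @[s --> t^'-] --> ((a t)%:R : R) &
      1 <= pkt_right_limit a 0].

Section delay_bounds.
Context {M : nat} (c : R) (alpha_pkt : 'I_M -> R -> nat).
Context (Lmin Lmax : 'I_M -> R) (beta : R -> \bar R) (f : 'I_M).

Definition total_minus (l t : R) : \bar R :=
  (\sum_(i < M) Lmax i * pkt_right_limit (alpha_pkt i) t - l)%:E.

Definition Delta_pkt : \bar R :=
  (hdev (total_minus (Lmax f)) beta + (Lmax f / c)%:E)%E.

Definition Delta_A : \bar R :=
  ereal_sup [set (hdev (total_minus l) beta + (l / c)%:E)%E
            | l in [set l : R | Lmin f <= l <= Lmax f]].

End delay_bounds.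
End curves.

(* Main.v *)
(* The value l = Lmax f of the supremum defining Delta_A is Delta_pkt, whence
   the inequality and the equality for constant packet sizes.  The total arrival
   curve is at least Lmax f on [0, +oo[, so for l < Lmax f the argument of the
   pseudo-inverse of beta is positive.  For a rate-latency curve of rate < c,
   lowering l increases the horizontal deviation by (Lmax f - l) / rate, which
   exceeds the loss (Lmax f - l) / c on the transmission time.  In general, a
   step function beta jumping past total 0 - Lmax f at the first increase of
   the total arrival curve separates the two bounds for l close to Lmax f. *)
Require Import Defs.
From HB Require Import structures.
From mathcomp Require Import all_boot all_order all_algebra.
From mathcomp Require Import all_classical all_reals all_analysis.
From mathcomp Require Import lra.

Set Implicit Arguments.
Unset Strict Implicit.
Unset Printing Implicit Defensive.

Import Order.TTheory GRing.Theory Num.Theory.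
Import numFieldNormedType.Exports.

Local Open Scope classical_set_scope.
Local Open Scope ring_scope.

(** * Pseudo-inverses and horizontal deviations *)

Section pseudo_inverse.
Context {R : realType}.
Implicit Types (w : R -> \bar R) (x y : \bar R).

Lemma lower_pinv_le w x s : 0 <= s -> (x <= w s)%E -> (lower_pinv w x <= s%:E)%E.
Proof. by move=> s0 xs; apply: ereal_inf_lbound; exists s. Qed.

Lemma le_lower_pinv w x y :
  (forall s, 0 <= s -> (x <= w s)%E -> (y <= s%:E)%E) -> (y <= lower_pinv w x)%E.
Proof. by move=> H; apply: le_ereal_inf_tmp => _ [s [s0 xs] <-]; exact: H. Qed.

Lemma hdev_le (w' : R -> \bar R) w y :
  (forall t, 0 <= t -> (lower_pinv w (w' t) - t%:E <= y)%E) -> (hdev w' w <= y)%E.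
Proof. by move=> H; apply: ge_ereal_sup => _ [t t0 <-]; exact: H. Qed.

Lemma le_hdev (w' : R -> \bar R) w t :
  0 <= t -> (lower_pinv w (w' t) - t%:E <= hdev w' w)%E.
Proof. by move=> t0; apply: ereal_sup_ubound; exists t. Qed.

Lemma lower_pinv_rate_latency_le (rate latency x : R) :
  0 < rate -> 0 <= latency -> 0 <= x ->
  (lower_pinv (rate_latency rate latency) x%:E <= (latency + x / rate)%:E)%E.
Proof.
move=> r0 T0 x0; have xr : 0 <= x / rate by rewrite divr_ge0// ltW.
apply: lower_pinv_le; first exact: addr_ge0.
by rewrite /rate_latency addrC addKr max_l// mulrC divfK// gt_eqF.
Qed.

(** Strict positivity of [x] matters: at [x = 0] the pseudo-inverse is 0, not [latency]. *)
Lemma lower_pinv_rate_latency_ge (rate latency x : R) :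
  0 < rate -> 0 < x ->
  ((latency + x / rate)%:E <= lower_pinv (rate_latency rate latency) x%:E)%E.
Proof.
move=> r0 x0; apply: le_lower_pinv => s s0.
rewrite /rate_latency !lee_fin; case: (leP (s - latency) 0) => [_|_].
  by rewrite mulr0 leNgt x0.
by rewrite -lerBrDl ler_pdivrMr// mulrC.
Qed.

End pseudo_inverse.

(** * Right limits of packet-level arrival curves *)

Section right_limits.
Context {R : realType}.
Implicit Types a : R -> nat.

(* A nondecreasing nat-valued function attains its infimum over s > t, so it
   is constant just after t. *)
Lemma pkt_right_limit_near a t : pkt_arrival_curve a -> 0 <= t ->
  \forall s \near t^'+, (a s)%:R = pkt_right_limit a t.
Proof.
move=> [_ a_nd _ _ _] t0.
have exP : exists n, `[< exists2 s, t < s & a s = n >].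
  by exists (a (t + 1)); apply/asboolP; exists (t + 1); rewrite ?ltrDl ?ltr01.
case: (ex_minnP exP) => n /asboolP[u tu au] minn.
have aE : \forall s \near t^'+, (a s)%:R = n%:R :> R.
  near=> s.
  have ts : t < s by near: s; exact: nbhs_right_gt.
  have su : s <= u by near: s; exact: nbhs_right_le.
  congr (_%:R); apply/eqP; rewrite eqn_leq -{1}au a_nd ?(le_trans t0) ?(ltW ts)//=.
  by apply: minn; apply/asboolP; exists s.
suff -> : pkt_right_limit a t = n%:R by [].
by apply: cvg_lim => //; apply: cvg_near_cst; apply: filterS aE => s ->.
Unshelve. all: by end_near. Qed.

Lemma pkt_right_limit_le a s t : pkt_arrival_curve a -> 0 <= s -> s < t ->
  pkt_right_limit a s <= (a t)%:R.
Proof.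
move=> aP s0 st; have [_ a_nd _ _ _] := aP.
near s^'+ => u.
have su : s < u by near: u; exact: nbhs_right_gt.
have <- : (a u)%:R = pkt_right_limit a s.
  by near: u; exact: pkt_right_limit_near.
rewrite ler_nat a_nd ?(le_trans s0) ?(ltW su)//.
by near: u; exact: nbhs_right_le.
Unshelve. all: by end_near. Qed.

Lemma pkt_right_limit_nondecreasing a s t : pkt_arrival_curve a ->
  0 <= s -> s <= t -> pkt_right_limit a s <= pkt_right_limit a t.
Proof.
move=> aP s0; have [_ a_nd _ _ _] := aP.
rewrite le_eqVlt => /predU1P[->//|st].
apply: (le_trans (pkt_right_limit_le aP s0 st)).
near t^'+ => v.
have tv : t < v by near: v; exact: nbhs_right_gt.
have <- : (a v)%:R = pkt_right_limit a t.
  by near: v; apply: pkt_right_limit_near; rewrite ?(le_trans s0 (ltW st)).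
by rewrite ler_nat a_nd// ltW// (le_lt_trans s0).
Unshelve. all: by end_near. Qed.

(** Finitely many flows share a point [u > 0] where each curve equals its right limit at 0;
    monotonicity settles the points before [u]. *)
Lemma pkt_right_limits_near0 (M : nat) (a : 'I_M -> R -> nat) :
  (forall i, pkt_arrival_curve (a i)) ->
  exists2 d : R, 0 < d & forall i t, 0 <= t -> t < d ->
    pkt_right_limit (a i) t = pkt_right_limit (a i) 0.
Proof.
move=> aP; near (0:R)^'+ => u.
have au i : (a i u)%:R = pkt_right_limit (a i) 0.
  have : forall i, (a i u)%:R = pkt_right_limit (a i) 0.
    by near: u; apply: filter_forall => j; exact: pkt_right_limit_near.
  exact.
exists u => [|i t t0 tu]; first by near: u; exact: nbhs_right_gt.
apply/eqP; rewrite eq_le -{1}au pkt_right_limit_le//=.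
exact: pkt_right_limit_nondecreasing.
Unshelve. all: by end_near. Qed.

End right_limits.

(** * Total arrival curve and comparison of the two bounds *)

Section total.
Context {R : realType} (M : nat) (alpha_pkt : 'I_M -> R -> nat).
Context (Lmax : 'I_M -> R) (f : 'I_M).
Hypotheses (alphaP : forall i, pkt_arrival_curve (alpha_pkt i))
  (Lmax_ge0 : forall i, 0 <= Lmax i).

Local Notation S t := (\sum_(i < M) Lmax i * pkt_right_limit (alpha_pkt i) t).

(** Each right limit is at least 1, so the term of [f] alone suffices. *)
Lemma Lmax_le_total t : 0 <= t -> Lmax f <= S t.
Proof.
move=> t0; have ge1 i : 1 <= pkt_right_limit (alpha_pkt i) t.
  have [_ _ _ _ /le_trans] := alphaP i; apply.
  exact: pkt_right_limit_nondecreasing.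
rewrite (bigD1 f)//= -[leLHS]addr0 lerD ?ler_peMr//.
by apply: sumr_ge0 => i _; rewrite mulr_ge0// (le_trans ler01).
Qed.

Lemma total_near0 : exists2 d : R, 0 < d & forall t, 0 <= t -> t < d -> S t = S 0.
Proof.
have [d d0 dP] := pkt_right_limits_near0 alphaP.
by exists d => // t t0 td; apply: eq_bigr => i _; rewrite dP.
Qed.

Lemma total_le s t : 0 <= s -> s < t ->
  S s <= \sum_(i < M) Lmax i * (alpha_pkt i t)%:R.
Proof.
by move=> s0 st; apply: ler_sum => i _; rewrite ler_wpM2l// pkt_right_limit_le.
Qed.

Context (c : R) (Lmin : 'I_M -> R).
Hypotheses (c_gt0 : 0 < c).
Local Notation H l beta := (hdev (total_minus alpha_pkt Lmax l) beta).
Local Notation Dpkt beta := (Delta_pkt c alpha_pkt Lmax beta f).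
Local Notation DA beta := (Delta_A c alpha_pkt Lmin Lmax beta f).

Lemma le_Delta_A beta l : Lmin f <= l <= Lmax f ->
  (H l beta + (l / c)%:E <= DA beta)%E.
Proof. by move=> lP; apply: ereal_sup_ubound; exists l. Qed.

(** Finiteness of [Delta_pkt] excludes the case where both bounds are infinite. *)
Lemma Delta_lt_rate_latency (rate latency : R) : Lmin f < Lmax f ->
  0 < rate -> rate < c -> 0 <= latency ->
  (Dpkt (rate_latency rate latency) < +oo)%E ->
  (Dpkt (rate_latency rate latency) < DA (rate_latency rate latency))%E.
Proof.
move=> ltL r0 rc T0 Doo; set beta := rate_latency _ _ in Doo *.
(* [k t] uses the pseudo-inverse formula even where its argument [S t - Lmax f] vanishes; there it
   may exceed the true deviation. *)
pose k t := latency + (S t - Lmax f) / rate - t.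
pose K := ereal_sup [set (k t)%:E | t in [set t | 0 <= t]].
have HK : (H (Lmax f) beta <= K)%E.
  apply: hdev_le => t t0; apply: (@le_trans _ _ (k t)%:E).
    rewrite leeBlDr// -EFinD subrK lower_pinv_rate_latency_le//.
    by rewrite subr_ge0 Lmax_le_total.
  by apply: ereal_sup_ubound; exists t.
(* Where [S t = Lmax f], only [k t <= latency] is available. This bound serves to make [K]
   finite. *)
have KH : (K <= maxe (H (Lmax f) beta) latency%:E)%E.
  apply: ge_ereal_sup => _ [t t0 <-]; rewrite le_max.
  have := Lmax_le_total t0; rewrite le_eqVlt => /predU1P[SE|ltS].
    by apply/orP; right; rewrite lee_fin /k -SE subrr mul0r addr0 gerBl.
  apply/orP; left; apply: le_trans (le_hdev _ _ t0).
  by rewrite leeBrDr// -EFinD subrK lower_pinv_rate_latency_ge// subr_gt0.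
have Hoo : (H (Lmax f) beta < +oo)%E.
  move: Doo; rewrite !ltey; apply: contraNN => /eqP Hoo.
  by rewrite /Delta_pkt Hoo.
have Kfin : K \is a fin_num.
  rewrite fin_numElt (le_lt_trans KH) ?gt_max ?Hoo ?ltry//= andbT.
  rewrite (@lt_le_trans _ _ (k 0)%:E) ?ltNyr//.
  by apply: ereal_sup_ubound; exists 0; rewrite /= ?lexx.
(* [S t - Lmin f] is always positive, so the formula holds at every [t], and the shift from [k t]
   does not depend on [t]. *)
have AH : (K + ((Lmax f - Lmin f) / rate)%:E <= H (Lmin f) beta)%E.
  rewrite -leeBrDr//; apply: ge_ereal_sup => _ [t t0 <-].
  rewrite leeBrDr// -EFinD; apply: le_trans (le_hdev _ _ t0).
  rewrite leeBrDr// -EFinD.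
  have -> : k t + (Lmax f - Lmin f) / rate + t = latency + (S t - Lmin f) / rate.
    by rewrite /k; lra.
  by rewrite lower_pinv_rate_latency_ge// subr_gt0 (lt_le_trans ltL) ?Lmax_le_total.
have lP : Lmin f <= Lmin f <= Lmax f by rewrite lexx ltW.
apply: lt_le_trans (le_Delta_A beta lP).
apply: (@le_lt_trans _ _ (K + (Lmax f / c)%:E)%E); first exact: leeD.
apply: (@lt_le_trans _ _ (K + ((Lmax f - Lmin f) / rate)%:E + (Lmin f / c)%:E)%E).
  rewrite -addeA -EFinD lteD2lE// lte_fin -ltrBlDr -mulrBl.
  by rewrite ltr_pM2l ?subr_gt0// ltf_pV2.
exact: leeD.
Qed.

(* beta equals total 0 - Lmax f on ]0, d] and +oo afterwards, where the total
   is constant on [0, d[: the deviation is 0 for l = Lmax f, and at least d for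
   every l < Lmax f. *)
Lemma exists_Delta_lt : Lmin f < Lmax f -> exists beta : R -> \bar R,
  F0inc beta /\ (Dpkt beta < DA beta)%E.
Proof.
move=> ltL; have [d d0 Sd] := total_near0.
pose beta (t : R) : \bar R :=
  if t <= 0 then 0%E else if t <= d then (S 0 - Lmax f)%:E else +oo%E.
have m0 : 0 <= S 0 - Lmax f by rewrite subr_ge0 Lmax_le_total.
have beta_ge0 t : (0 <= beta t)%E.
  by rewrite /beta; case: ifP => // _; case: ifP; rewrite ?lee_fin.
exists beta; split.
  split=> [|s t s0 st]; first by rewrite /beta lexx.
  have [s_le0|s_gt0] := leP s 0; first by rewrite [beta s]/beta s_le0.
  rewrite /beta [s <= 0]leNgt [t <= 0]leNgt s_gt0 (lt_le_trans s_gt0 st)/=.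
  by have [td|_] := leP t d; [rewrite (le_trans st td)|exact: leey].
(* Transmission then loses at most [d / 2], less than the gain [d] in deviation. *)
pose l := Num.max (Lmin f) (Lmax f - c * d / 2).
have cd0 : 0 < c * d by rewrite mulr_gt0.
have lL : l < Lmax f by rewrite /l gt_max ltL/=; lra.
have lP : Lmin f <= l <= Lmax f by rewrite (ltW lL) andbT /l le_max lexx.
apply: lt_le_trans (le_Delta_A beta lP).
apply: (@le_lt_trans _ _ (Lmax f / c)%:E).
  (* Just after [t], [beta] is at least [S t - Lmax f]: by constancy of the total up to [d], by its
     infinite value beyond. *)
  rewrite -[leRHS]add0e leeD//; apply: hdev_le => t t0.
  rewrite leeBlDr// add0e; apply/lee_addgt0Pr => e e0.
  have te0 : 0 < t + e by rewrite ltr_wpDl.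
  apply: lower_pinv_le; first exact: ltW.
  rewrite /beta [t + e <= 0]leNgt te0/=.
  have [ted|_] := leP (t + e) d; last exact: leey.
  by rewrite lee_fin Sd// (lt_le_trans _ ted)// ltrDl.
apply: (@lt_le_trans _ _ (d + l / c)%:E).
  rewrite lte_fin ltr_pdivrMr// mulrDl divfK ?gt_eqF//.
  have : Lmax f - c * d / 2 <= l by rewrite /l le_max lexx orbT.
  by lra.
(* At [t = 0], the level [S 0 - l] exceeds every value of [beta] up to [d]. *)
rewrite EFinD leeD//; apply: le_trans (le_hdev _ _ (lexx 0)).
rewrite sube0; apply: le_lower_pinv => s s0; apply: contraTT.
rewrite -!ltNge lte_fin => sd; rewrite /beta (ltW sd).
by case: ifP => _; rewrite lte_fin; lra.
Qed.

Lemma Delta_pkt_rate_latency_fin (rate b : R) : 0 < rate ->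
  (forall t, 0 <= t ->
     \sum_(i < M) Lmax i * (alpha_pkt i t)%:R <= rate * t + b) ->
  (Dpkt (rate_latency rate 0) < +oo)%E.
Proof.
move=> r0 Sb; apply: lte_add_pinfty; last exact: ltry.
(* The 1 pays for bounding the right limits at [t] by the curves at [t + 1]. *)
apply: (@le_lt_trans _ _ (1 + (b - Lmax f) / rate)%:E); last exact: ltry.
apply: hdev_le => t t0; rewrite leeBlDr// -EFinD.
apply: le_trans (lower_pinv_rate_latency_le r0 (lexx 0) _) _.
  by rewrite subr_ge0 Lmax_le_total.
rewrite lee_fin add0r ler_pdivrMr// addrAC [leRHS]mulrDl divfK ?gt_eqF//.
have t10 : 0 <= t + 1 by rewrite addr_ge0.
have tt1 : t < t + 1 by rewrite ltrDl.
by have := le_trans (total_le t0 tt1) (Sb _ t10); lra.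
Qed.

End total.

(** The last clause complements the finiteness condition: an affine bound of slope below [c] on the
    total guarantees a suitable rate-latency curve. *)
Theorem proposition3 (R : realType) (M : nat) (c : R)
    (alpha_pkt : 'I_M -> R -> nat) (Lmin Lmax : 'I_M -> R) (f : 'I_M)
    (c_gt0 : 0 < c)
    (alphaP : forall i, pkt_arrival_curve (alpha_pkt i))
    (LP : forall i, 0 <= Lmin i <= Lmax i) :
  (forall beta : R -> \bar R, F0inc beta ->
     (Delta_pkt c alpha_pkt Lmax beta f
        <= Delta_A c alpha_pkt Lmin Lmax beta f)%E) /\
  (Lmin f = Lmax f ->
     forall beta : R -> \bar R, F0inc beta ->
     Delta_pkt c alpha_pkt Lmax beta f
       = Delta_A c alpha_pkt Lmin Lmax beta f) /\
  (Lmin f < Lmax f ->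
     (exists beta : R -> \bar R, F0inc beta /\
        (Delta_pkt c alpha_pkt Lmax beta f
           < Delta_A c alpha_pkt Lmin Lmax beta f)%E) /\
     (forall rate latency : R, 0 < rate -> rate < c -> 0 <= latency ->
        (Delta_pkt c alpha_pkt Lmax (rate_latency rate latency) f < +oo)%E ->
        (Delta_pkt c alpha_pkt Lmax (rate_latency rate latency) f
           < Delta_A c alpha_pkt Lmin Lmax (rate_latency rate latency) f)%E) /\
     ((exists r b : R, r < c /\
         forall t : R, 0 <= t ->
           \sum_(i < M) Lmax i * (alpha_pkt i t)%:R <= r * t + b) ->
      exists rate latency : R, [/\ 0 < rate, rate < c, 0 <= latency &
        (Delta_pkt c alpha_pkt Lmax (rate_latency rate latency) f
           < Delta_A c alpha_pkt Lmin Lmax (rate_latency rate latency) f)%E])).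
Proof.
have Lmax_ge0 i : 0 <= Lmax i by have /andP[/le_trans] := LP i; apply.
have LfP : Lmin f <= Lmax f <= Lmax f by rewrite lexx andbT; case/andP: (LP f).
split; first by move=> beta _; exact: le_Delta_A.
split.
  move=> LE beta _; rewrite /Delta_A LE.
  rewrite (_ : [set l | _] = [set Lmax f]) ?image_set1 ?ereal_sup1//.
  apply/seteqP; split=> [l|_ ->] /=; last by rewrite lexx.
  by move=> lP; apply/eqP; rewrite eq_le andbC.
move=> ltL; split; first exact: exists_Delta_lt.
split=> [rate latency *|[r [b [rc Sb]]]]; first exact: Delta_lt_rate_latency.
(* [r] may be nonpositive; the maximum with [c / 2] lies strictly between 0 and [c]. *)
pose rate := Num.max r (c / 2).
have rate0 : 0 < rate by rewrite /rate lt_max; apply/orP; right; lra.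
have ratec : rate < c by rewrite /rate gt_max rc/=; lra.
exists rate, 0; split=> //; apply: Delta_lt_rate_latency => //.
apply: (@Delta_pkt_rate_latency_fin _ _ _ _ _ _ _ _ _ b) => // t t0.
by apply: le_trans (Sb t t0) _; rewrite lerD2r ler_wpM2r// le_max lexx.
Qed.
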